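(* The three sets of occupation measures generated respectively by decentralized behavioral policy-profiles, by product mixtures of decentralized behavioral policy-profiles, and by product mixtures of decentralized pure policy-profiles coincide: $$\mathbf{p}_\infty^{(1)}\big(\mathcal{U}\big)=\mathbf{p}_\infty^{(1)}\Big(\prod_{n=1}^N \mathcal{M}_1\big(\mathcal{U}^{(n)}\big)\Big)=\mathbf{p}_\infty^{(1)}\Big(\prod_{n=1}^N \mathcal{M}_1\big(\mathcal{U}^{(n)}_{\mathrm{pure}}\big)\Big).$$
   Context: Model. $N\in\mathbb{N}$ agents. The state space $\mathcal{S}$ is a topological space with Borel $\sigma$-algebra $\mathcal{B}(\mathcal{S})$. The joint-observation space $\mathcal{O}=\mathcal{O}^{(0)}\times\mathcal{O}^{(1)}\times\cdots\times\mathcal{O}^{(N)}$ is countable and discrete ($\mathcal{O}^{(0)}$: common observations; $\mathcal{O}^{(n)}$: private observations of agent $n$). The joint-action space $\mathcal{A}=\mathcal{A}^{(1)}\times\cdots\times\mathcal{A}^{(N)}$ is finite and discrete. The initial pair $(S_1,O_1)$ has law $P_1$, a probability measure on $\mathcal{S}\times\mathcal{O}$. Given all past states, observations and actions, and the current $S_t=s$, $A_t=a$, one has $\mathbb{P}(S_{t+1}\in B,O_{t+1}=o\mid\cdot)=P(s,a,B,o)$ for $B\in\mathcal{B}(\mathcal{S})$, $o\in\mathcal{O}$, where $P$ is a fixed transition probability, measurable in $(s,a,o)$ for each $B$. At time $t\in\mathbb{N}$ agent $n$ observes $O_t^{(0)}$ and $O_t^{(n)}$ and then chooses $A_t^{(n)}\in\mathcal{A}^{(n)}$;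 actions are forever private. Histories. The common history at time $t$ is $h_t^{(0)}=o^{(0)}_{1:t}\in\mathcal{H}_t^{(0)}=(\mathcal{O}^{(0)})^t$. The private history of agent $n$ is $h_t^{(n)}=(o^{(n)}_{1:t},a^{(n)}_{1:t-1})\in\mathcal{H}_t^{(n)}=(\mathcal{O}^{(n)})^t\times(\mathcal{A}^{(n)})^{t-1}$. The joint-history is $h_t=(o_{1:t},a_{1:t-1})=(h_t^{(0)},h_t^{(1)},\dots,h_t^{(N)})\in\mathcal{H}_t$. Write $h_t^{(0,n)}=(h_t^{(0)},h_t^{(n)})\in\mathcal{H}_t^{(0,n)}=\mathcal{H}_t^{(0)}\times\mathcal{H}_t^{(n)}$. Policies. $\mathcal{M}_1(Y)$ denotes the set of Borel probability measures on $Y$. A behavioral policy of agent $n$ is $u^{(n)}=(u^{(n)}_t)_{t\ge1}\in\mathcal{U}^{(n)}$ with $u^{(n)}_t:\mathcal{H}_t^{(0,n)}\to\mathcal{M}_1(\mathcal{A}^{(n)})$. It is pure if every $u_t^{(n)}(h_t^{(0,n)})$ is a Dirac measure; $\mathcal{U}^{(n)}_{\mathrm{pure}}\subseteq\mathcal{U}^{(n)}$ is the set of pure policies. $\mathcal{U}=\prod_{n=1}^N\mathcal{U}^{(n)}$ is the set of decentralized behavioral policy-profiles. Under $u\in\mathcal{U}$, given $h_t$, the joint action $a_t$ is chosen with probability $\prod_{n=1}^N u^{(n)}_t(a^{(n)}_t\mid h^{(0,n)}_t)$ (independently of the current and past states given $h_t$); $\mathbb{P}^{u}_{P_1}$ is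 the resulting law of $(S_t,O_t,A_t)_{t\ge1}$. Topology. $\mathcal{U}^{(n)}$ is identified with $\prod_{t\ge1}\prod_{h\in\mathcal{H}_t^{(0,n)}}\mathcal{M}_1(\mathcal{A}^{(n)})$ and has the product topology, each factor having the topology of weak convergence; $\mathcal{U}^{(n)}_{\mathrm{pure}}$ has the subspace topology. Mixtures. An element $\mu$ of $\prod_{n=1}^N\mathcal{M}_1(\mathcal{U}^{(n)})$ or $\prod_{n=1}^N\mathcal{M}_1(\mathcal{U}_{\mathrm{pure}}^{(n)})$ is a tuple $(\mu^{(1)},\dots,\mu^{(N)})$, identified with the product measure $\mu^{(1)}\otimes\cdots\otimes\mu^{(N)}$ on policy-profiles: a policy-profile is drawn from it at time $0$ and then used forever, so $\mathbb{P}^{\mu}_{P_1}(h_t,a_t)=\int\mathbb{P}^{u}_{P_1}(h_t,a_t)\,\mu(du)$. Occupation measures. For a policy-profile or mixture $x$, $\mathbf{p}_\infty^{(1)}(x)=\{\mathbb{P}^{x}_{P_1}(h_t,a_t): t\in\mathbb{N},h_t\in\mathcal{H}_t,a_t\in\mathcal{A}\}$, viewed as a function (measure) on $\bigcup_{t\ge1}(\mathcal{H}_t\times\mathcal{A})$. For a set $X$, $\mathbf{p}_\infty^{(1)}(X)=\{\mathbf{p}_\infty^{(1)}(x):x\in X\}$. *)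

(* Defs.v *)
From HB Require Import structures.
From mathcomp Require Import all_boot all_order all_algebra.
From mathcomp Require Import all_classical all_reals all_analysis.

Set Implicit Arguments.
Unset Strict Implicit.
Unset Printing Implicit Defensive.

Import Order.TTheory GRing.Theory Num.Theory.
Import numFieldNormedType.Exports.

Local Open Scope classical_set_scope.
Local Open Scope ring_scope.

(* Measurable types are pointed in the library, hence nonempty countable and
   nonempty finite types. *)
#[short(type="pcountType")]
HB.structure Definition PointedCountable := {T of Countable T & isPointed T}.

#[short(type="pfinType")]
HB.structure Definition PointedFinite := {T of Finite T & isPointed T}.

HB.instance Definition _ (I : finType) (T : I -> pointedType) :=
  isPointed.Build {dffun forall i, T i} [ffun i => point].

(* [discrete_topology T] is canonically a pointed topological space for
   [T = bool] only. *)
Definition discrete (T : Type) : Type := discrete_topology T.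

HB.instance Definition _ (T : choiceType) :=
  DiscreteTopology.copy (discrete T) (discrete_topology T).
HB.instance Definition _ (T : pointedType) :=
  Pointed.copy (discrete T) (discrete_topology T).

Notation borel Y := (g_sigma_algebraType (@open Y)).

(** Borel probability measures with the topology of weak convergence: the
    initial topology of the maps [m |-> \int[m]_y f y], [f] bounded and
    continuous. *)
Section borel_probability_measures.
Context (R : realType) (Y : ptopologicalType).

Definition bounded_continuous : Type :=
  {f : Y -> R | continuous f /\ bounded_fun f}.

Definition weak_eval (m : probability (borel Y) R) :
    prod_topology (fun _ : bounded_continuous => R) :=
  fun f => Rintegral m setT (sval f).

Definition M1 : Type := initial_topology weak_eval.

HB.instance Definition _ := Topological.copy M1 (initial_topology weak_eval).
HB.instance Definition _ := Pointed.copy M1 (probability (borel Y) R).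

End borel_probability_measures.

(** Product [mu_0 \x ... \x mu_(k-1)] of probabilities on possibly distinct
    measurable spaces; [prod_probability_box] is its characteristic property. *)
Section product_probability.
Context (R : realType) (k : nat) (d : 'I_k -> measure_display)
  (T : forall i, measurableType (d i)).

Definition coordinate_sets : set (set (forall i, T i)) :=
  [set C | exists i (B : set (T i)), measurable B /\ C = [set x | B (x i)]].

Definition prod_space := g_sigma_algebraType coordinate_sets.

Definition set_coord (i : 'I_k) (p : T i * prod_space) : prod_space :=
  dfwith p.2 i p.1.

Lemma measurable_set_coord (i : 'I_k) :
  measurable_fun [set: T i * prod_space] (@set_coord i).
Proof.
apply: (@measurability _ _ _ _ setT (@set_coord i) coordinate_sets) => //.
move=> _ [_ [j [B [mB ->]] <-]]; rewrite setTI.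
have [ij|ij] := eqVneq i j; first subst j.
- rewrite [X in measurable X](_ : _ = @fst (T i) prod_space @^-1` B).
    by rewrite -[X in measurable X]setTI; exact: measurable_fst.
  by apply/seteqP; split => -[x y]; rewrite /set_coord/= dfwithin.
- rewrite [X in measurable X](_ : _ =
      @snd (T i) prod_space @^-1` [set x | B (x j)]).
    rewrite -[X in measurable X]setTI; apply: measurable_snd => //.
    by apply: sub_sigma_algebra; exists j, B.
  by apply/seteqP; split => -[x y]; rewrite /set_coord/= dfwithout.
Qed.

HB.instance Definition _ (i : 'I_k) := isMeasurableFun.Build _ _ _ _
  (@set_coord i) (@measurable_set_coord i).

Variable mu : forall i, probability (T i) R.

Fixpoint prod_probability_seq (s : seq 'I_k) : probability prod_space R :=
  if s is i :: s' then
    distribution (mu i \x prod_probability_seq s')%E (@set_coord i)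
  else \d_(point : prod_space).

Definition prod_probability : probability prod_space R :=
  prod_probability_seq (enum 'I_k).

Lemma prod_probability_box (B : forall i, set (T i)) :
  (forall i, measurable (B i)) ->
  prod_probability [set x | forall i, B i (x i)] = (\prod_(i < k) mu i (B i))%E.
Proof.
move=> mB; rewrite /prod_probability.
have -> : [set x : prod_space | forall i, B i (x i)] =
    [set x | forall i, i \in enum 'I_k -> B i (x i)].
  by apply/seteqP; split => x /= Bx i => [_|]; apply: Bx; rewrite ?mem_enum.
have -> : (\prod_(i < k) mu i (B i) = \prod_(i <- enum 'I_k) mu i (B i))%E.
  by rewrite enumT.
have := enum_uniq 'I_k; elim: (enum 'I_k) => [_|i s IHs /= /andP[iNs us]].
  rewrite big_nil (_ : [set _ | _] = setT) ?probability_setT//.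
  by apply/seteqP; split.
have mC : measurable [set x : prod_space | forall j, j \in s -> B j (x j)].
  elim: s {IHs iNs us} => [|j s IH].
    rewrite (_ : [set _ | _] = setT); first exact: measurableT.
    by apply/seteqP; split.
  rewrite (_ : [set _ | _] = [set x | B j (x j)] `&`
      [set x : prod_space | forall j, j \in s -> B j (x j)]).
    by apply: measurableI => //; apply: sub_sigma_algebra; exists j, (B j).
  apply/seteqP; split => x /= => [Bx|[Bj Bs] l].
    by split => [|l ls]; apply: Bx; rewrite in_cons ?eqxx// ls orbT.
  by rewrite in_cons => /predU1P[->//|]; exact: Bs.
rewrite big_cons -IHs// -product_measure1E//= /distribution /pushforward.
congr (_ _); apply/seteqP; split => -[x y] /=; rewrite /set_coord/=.
  move=> h; split; first by have := h i (mem_head _ _); rewrite dfwithin.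
  move=> j js; have := h j; rewrite in_cons js orbT => /(_ isT).
  by rewrite dfwithout//; apply: contraNneq iNs => ->.
move=> [Bx By] j; rewrite in_cons => /predU1P[->|js]; first by rewrite dfwithin.
rewrite dfwithout; first exact: By.
by apply: contraNneq iNs => ->.
Qed.

End product_probability.

Section model.
Context (R : realType) (N : nat) (S : ptopologicalType).
Context (O0 : pcountType) (O : 'I_N -> pcountType) (A : 'I_N -> pfinType).

(** Times are shifted by one: index [t] below stands for time [t + 1]. *)

Definition obs := (O0 * {dffun forall n, O n})%type.
Definition act := {dffun forall n, A n}.

Definition hist (t : nat) := (t.+1.-tuple obs * t.-tuple act)%type.

(* Common and private history of agent [n]. *)
Definition hist0n (n : 'I_N) (t : nat) :=
  (t.+1.-tuple O0 * (t.+1.-tuple (O n) * t.-tuple (A n)))%type.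

Definition local_hist (n : 'I_N) t (h : hist t) : hist0n n t :=
  ([tuple of [seq o.1 | o <- h.1]],
   ([tuple of [seq (o.2 : {dffun _}) n | o <- h.1]],
    [tuple of [seq (a : {dffun _}) n | a <- h.2]])).

(* The nested product topology is the product topology over all pairs of a
   time and a history at that time. *)
Definition policy (n : 'I_N) : Type :=
  prod_topology (fun t : nat =>
    prod_topology (fun _ : hist0n n t => M1 R (discrete (A n)))).

HB.instance Definition _ n := Topological.on (policy n).
HB.instance Definition _ n :=
  Pointed.copy (policy n)
    (forall t, hist0n n t -> probability (borel (discrete (A n))) R).

Definition is_pure n (u : policy n) : Prop :=
  forall t (h : hist0n n t), exists a : borel (discrete (A n)),
    (u t h : probability _ _) = \d_a :> (set _ -> \bar R).

(* [set_type] carries the subspace topology. *)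
Definition pure_policy (n : 'I_N) : Type := set_type [set u : policy n | is_pure u].

Lemma is_pure_dirac n (a : borel (discrete (A n))) :
  is_pure ((fun _ _ => \d_a : probability _ _) : policy n).
Proof. by move=> t h; exists a. Qed.

HB.instance Definition _ n :=
  Topological.copy (pure_policy n) (set_type [set u : policy n | is_pure u]).
HB.instance Definition _ n :=
  isPointed.Build (pure_policy n) (SigSub (mem_set (@is_pure_dirac n point))).

Definition profile := forall n, policy n.

Definition pure_profile_val (v : forall n, pure_policy n) : profile :=
  fun n => set_val (v n).

(* As [obs] is countable and discrete, the product sigma-algebra below is the
   Borel sigma-algebra of the product space. *)
Variable P1 : probability (borel S * borel (discrete obs))%type R.
Variable P : R.-pker (borel S * borel (discrete act))%type ~>
                     (borel S * borel (discrete obs))%type.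

Definition stage := (S * obs * act)%type.

(* Law of the next state and observation given the past stages [w]: the initial
   law if [w] is empty, else the transition from the last state and action. *)
Definition next_state_obs (w : seq stage) :
    set (borel S * borel (discrete obs)) -> \bar R :=
  if rev w is (s, _, a) :: _ then P (s, a) else P1.

Definition hist_after (w : seq stage) (o : obs) : hist (size w) :=
  ([tuple of rcons [tuple of [seq z.1.2 | z <- in_tuple w]] o],
   [tuple of [seq z.2 | z <- in_tuple w]]).

(* Agents randomize independently, each on its own information. *)
Definition act_prob (u : profile) t (h : hist t) (a : act) : \bar R :=
  (\prod_(n < N) u n t (local_hist n h) [set a n])%E.

(** Probability under [u], given the first stages [w], that [w] followed by the
    next [k] stages is in [E]: given the past, a new stage is drawn by sampling
    the next state and observation [so] from [next_state_obs], and then the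
    joint action from [act_prob]. So [path_prob u k [::]] is the law of the
    first [k] stages (state, observation, action) of the process controlled by
    [u], i.e. the marginal of its law given by the Ionescu-Tulcea theorem. *)
Fixpoint path_prob (u : profile) (k : nat) (w : seq stage)
    (E : set (seq stage)) : \bar R :=
  if k is k'.+1 then
    (\int[next_state_obs w]_so
       \sum_(a : act) act_prob u (hist_after w so.2) a *
                      path_prob u k' (rcons w (so.1, so.2, a)) E)%E
  else (\1_E w)%:E.

Definition hist_act_event t (h : hist t) (a : act) : set (seq stage) :=
  [set w | [seq z.1.2 | z <- w] = h.1 /\ [seq z.2 | z <- w] = rcons h.2 a].

(* The disjoint union of the sets [hist t * act]. *)
Definition hist_act := {t : nat & (hist t * act)%type}.

Definition occupation (u : profile) : hist_act -> \bar R :=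
  fun x => path_prob u (tag x).+1 [::] (hist_act_event (tagged x).1 (tagged x).2).

Definition occupation_mixture (mu : forall n, M1 R (policy n)) :
    hist_act -> \bar R :=
  fun x => (\int[prod_probability mu]_u occupation u x)%E.

Definition occupation_pure_mixture (mu : forall n, M1 R (pure_policy n)) :
    hist_act -> \bar R :=
  fun x => (\int[prod_probability mu]_v occupation (pure_profile_val v) x)%E.

End model.

(* Main.v *)
From HB Require Import structures.
Require Import Defs.
From mathcomp Require Import all_boot all_order all_algebra.
From mathcomp Require Import all_classical all_reals all_analysis.
From mathcomp Require Import measurable_realfun lra.

(* Every joint occupation probability factors into a policy-free term times the
   product over the agents of the realization weights, i.e. the products of the
   action probabilities along the agent's private play; since mixtures are
   product measures, averaging acts on each agent's weight separately. All three
   sets are therefore obtained from the same objects, the plans: nonnegative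
   functions [W] of the plays with [W [::] = 1] and [\sum_a W ((o, a) :: z) = W z].
   A (mean) weight is a plan by linearity. Conversely a plan is the weight of the
   behavioral policy [W ((o, a) :: z) / W z] (Kuhn), hence of a Dirac mixture; it
   is also the mean weight of a random pure policy driven by one uniform variable
   [x]: cut [0, 1[ into nested intervals, one of length [W z] for each play [z],
   and let the policy play, after [z] and [o], the action [a] whose interval for
   [(o, a) :: z] contains [x]. *)

Set Implicit Arguments.
Unset Strict Implicit.
Unset Printing Implicit Defensive.

Import Order.TTheory GRing.Theory Num.Theory.
Import numFieldNormedType.Exports.

Local Open Scope classical_set_scope.
Local Open Scope ring_scope.

(** * Scaling of integrals of nonnegative functions *)

Section integration.
Context d (T : measurableType d) (R : realType).

(* [ge0_integralZl] without measurability: the integral of a nonnegative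
   function is a supremum over the simple functions below it. *)
Lemma ge0_nonmeasurable_integralZl (mu : {measure set T -> \bar R}) (k : R)
    (f : T -> \bar R) : 0 <= k -> (forall x, 0 <= f x)%E ->
  (\int[mu]_x (k%:E * f x) = k%:E * \int[mu]_x f x)%E.
Proof.
rewrite le_eqVlt => /predU1P[<- _|k0 f0].
  by rewrite mul0e integral0_eq// => x _; rewrite mul0e.
(* One inequality suffices: [r = k] applied to [f] and [r = k^-1] applied to [k * f] give the two
   directions. *)
suff scale (r : R) (g : T -> \bar R) : ((0 < r)%R -> (forall x, 0 <= g x) ->
    \int[mu]_x g x <= r^-1%:E * \int[mu]_x (r%:E * g x))%E.
  apply/eqP; rewrite eq_le; apply/andP; split.
    have := scale k^-1 (fun x => k%:E * f x)%E; rewrite invr_gt0 invrK.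
    have kf : (fun x => k^-1%:E * (k%:E * f x))%E = f.
      apply/funext => x; rewrite muleA -EFinM mulVf ?mul1e//.
      by rewrite gt_eqF.
    by rewrite kf; apply => // x; rewrite mule_ge0// lee_fin ltW.
  by rewrite muleC -lee_pdivlMr//; rewrite muleC; exact: scale.
move=> r0 g0.
have rg0 x : (0 <= r%:E * g x)%E by rewrite mule_ge0// lee_fin ltW.
rewrite !ge0_integralTE//; apply: ge_ereal_sup => _ [h hg <-].
rewrite lee_pdivlMl// -sintegralrM; apply: ereal_sup_ubound.
exists (mul_nnsfun (cst_nnsfun T (NngNum (ltW r0))) h) => //= x.
by rewrite EFinM lee_wpmul2l// lee_fin ltW.
Qed.

End integration.

(** * Integration against a product probability *)

Section product_integral.
Context (R : realType) (k : nat) (d : 'I_k -> measure_display)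
  (T : forall i, measurableType (d i)) (mu : forall i, probability (T i) R).

Lemma measurable_coordinate (i : 'I_k) :
  measurable_fun setT (fun x : prod_space T => x i).
Proof.
by move=> _ B mB; rewrite setTI; apply: sub_sigma_algebra; exists i, B.
Qed.

(** Induction on the list of coordinates that builds [prod_probability]. Each step is a push-forward
    along [set_coord], which leaves the other factors unchanged because the list has no repetition;
    Tonelli's theorem then splits off the new factor. *)
Lemma ge0_integral_prod (f : forall i, T i -> R) :
  (forall i x, 0 <= f i x) -> (forall i, measurable_fun setT (f i)) ->
  (\int[prod_probability mu]_x (\prod_(i < k) f i (x i))%:E =
   \prod_(i < k) \int[mu i]_x (f i x)%:E)%E.
Proof.
move=> f0 mf; rewrite /prod_probability.
under eq_integral do rewrite -big_enum/=.
rewrite -[RHS]big_enum/=.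
have := enum_uniq 'I_k; elim: (enum 'I_k) => [_|i s IHs /= /andP[iNs us]].
  rewrite !big_nil; under eq_integral do rewrite big_nil.
  by rewrite integral_cst//= mul1e; exact: probability_setT.
have mprod s' : measurable_fun setT
    (fun x : prod_space T => (\prod_(j <- s') f j (x j))%:E : \bar R).
  apply/measurable_EFinP/measurable_prod => j _.
  exact: (measurableT_comp (mf j) (@measurable_coordinate j)).
have prod0 s' (x : prod_space T) : (0 <= (\prod_(j <- s') f j (x j))%:E)%E.
  by rewrite lee_fin prodr_ge0.
rewrite /distribution
  (ge0_integral_pushforward (@measurable_set_coord _ _ _ i)) //.
rewrite preimage_setT.
pose g (z : T i * prod_space T) : \bar R :=
  ((f i z.1)%:E * (\prod_(j <- s) f j (z.2 j))%:E)%E.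
rewrite (_ : _ \o _ = g); last first.
  apply/funext => -[x y]; rewrite /g /= big_cons -EFinM /set_coord dfwithin.
  congr (_ * _)%:E; apply: eq_big_seq => j js; rewrite dfwithout//.
  by apply: contraNneq iNs => ->.
have mg : measurable_fun setT g.
  apply: emeasurable_funM.
    by apply/measurable_EFinP; exact: measurableT_comp (mf i) measurable_fst.
  exact: measurableT_comp (mprod s) measurable_snd.
have g0 z : (0 <= g z)%E by rewrite mule_ge0// lee_fin.
rewrite fubini_tonelli1//=.
rewrite big_cons -IHs// /fubini_F /g /=.
set c := (\int[prod_probability_seq mu s]_x _)%E.
have c0 : (0 <= c)%E by apply: integral_ge0 => y _; exact: prod0.
rewrite (eq_integral (fun x => c * (f i x)%:E)%E) => [|x _].
  rewrite ge0_integralZl// 1?muleC//; first exact/measurable_EFinP.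
  by move=> x _; rewrite lee_fin.
by rewrite ge0_integralZl// 1?muleC// lee_fin.
Qed.

End product_integral.

(** * Initial and product topologies, and Borel measurability of continuous functions *)

Section initial_and_product_topologies.

Lemma cvg_initial (S : choiceType) (T : topologicalType) (f : S -> T)
    (F : set_system S) (s : initial_topology f) :
  Filter F -> f @ F --> f s -> F --> s.
Proof.
move=> FF cvF A /= [_ [[B oB <-] Bfs] sBA].
by apply: filterS sBA _; apply: cvF; exact: open_nbhs_nbhs.
Qed.

Lemma cvg_prod_topology (I : Type) (T : I -> topologicalType)
    (F : set_system (prod_topology T)) (f : prod_topology T) : Filter F ->
  (forall i, (fun g : prod_topology T => g i) @ F --> f i) -> F --> f.
Proof. by move=> FF cvF; apply/cvg_sup => i; exact: cvg_initial. Qed.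

Lemma prod_topology_continuous (I : Type) (T : I -> topologicalType) (i : I) :
  continuous (fun g : prod_topology T => g i).
Proof.
move=> f; have /cvg_sup/(_ i) cvf : nbhs f --> f by exact: cvg_id.
apply: cvg_trans (@initial_continuous _ _ (fun g : forall i, T i => g i) f).
by move=> A /= nA; exact: cvf.
Qed.

End initial_and_product_topologies.

Lemma borel_measurable_continuous (R : realType) (Y : ptopologicalType)
  (f : Y -> R) : continuous f -> measurable_fun setT (f : borel Y -> R).
Proof.
move=> /continuousP cf; apply: (measurability _ (RGenOpens.measurableE R)).
move=> _ [_ [a [b ->] <-]]; rewrite setTI; apply: sub_sigma_algebra.
exact/cf/interval_open.
Qed.

(** * Point masses of probabilities on a finite discrete space *)

Section discrete_measures.
Context (R : realType) (T : pfinType).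
Implicit Types (m : probability (borel (discrete T)) R) (a : T).

Lemma measurable_discrete (B : set (borel (discrete T))) : measurable B.
Proof. by apply: sub_sigma_algebra; exact: discrete_open. Qed.

Definition mass m a : R := fine (m [set a]).

Lemma mass_ge0 m a : 0 <= mass m a.
Proof. exact/fine_ge0/measure_ge0. Qed.

Lemma massE m a : m [set a] = (mass m a)%:E.
Proof.
by rewrite /mass fineK// fin_num_measure//; exact: measurable_discrete.
Qed.

Lemma mass_sum1 m : \sum_a mass m a = 1.
Proof.
have sumE (s : seq T) : uniq s ->
    m [set x : borel (discrete T) | (x : T) \in s] =
    (\sum_(a <- s) mass m a)%:E.
  elim: s => [_|a s IHs /= /andP[aNs us]].
    by rewrite big_nil -[RHS](measure0 m); congr (m _); apply/seteqP; split.
  rewrite big_cons EFinD -IHs// -massE -measureU//=; last 3 first.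
  - exact: measurable_discrete.
  - exact: measurable_discrete.
  - by apply/seteqP; split => // x [/= ->]; rewrite (negbTE aNs).
  congr (m _); apply/seteqP; split => x /=; rewrite inE.
    by move=> /predU1P[]; [left|right].
  by move=> [->|->]; rewrite ?eqxx ?orbT.
apply: EFin_inj; rewrite -big_enum/= -sumE ?enum_uniq//.
rewrite -(probability_setT m); congr (m _); apply/seteqP; split => // x _ /=.
by rewrite mem_enum.
Qed.

Lemma mass_le1 m a : mass m a <= 1.
Proof.
rewrite -(mass_sum1 m) (bigD1 a)//= lerDl sumr_ge0// => b _.
exact: mass_ge0.
Qed.

Lemma mass_dirac a b : mass (\d_(a : borel (discrete T))) b = (a == b)%:R.
Proof.
have ab : (a \in [set b]) = (a == b).
  by apply/idP/eqP => [/set_mem|->]; rewrite ?inE.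
by rewrite /mass /= /dirac indicE ab.
Qed.

(** [mass m a] is the integral of the indicator of [a], which is bounded, and continuous because the
    space is discrete; so it is one of the evaluations that define the weak topology. *)
Lemma mass_continuous a :
  continuous (fun m : M1 R (discrete T) => mass m a).
Proof.
have bc : continuous (\1_[set a] : discrete T -> R) /\
    bounded_fun (\1_[set a] : discrete T -> R).
  split; first by apply/continuousP => B _; exact: discrete_open.
  exists 1; split => // M M1 x _ /=; rewrite ger0_norm// indicE.
  by case: (_ \in _) => /=; lra.
rewrite (_ : (fun _ => _) = (fun g : prod_topology _ => g (exist _ _ bc)) \o
    (@weak_eval R (discrete T))); last first.
  apply/funext => m /=; rewrite /weak_eval /Rintegral/= integral_indic//.
    by rewrite setIT.
  exact: measurable_discrete.
have cw : continuous (@weak_eval R (discrete T) : M1 R (discrete T) -> _).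
  exact: initial_continuous.
move=> m.
apply: (@continuous_comp (M1 R (discrete T)) (prod_topology (fun _ => R)) R).
  exact: cw.
exact: (@prod_topology_continuous _ (fun _ => R)).
Qed.

End discrete_measures.

(** * Probabilities with prescribed point masses *)

Section mass_function_probability.
Context (R : realType) (T : pfinType) (p : T -> R).
Hypotheses (p_ge0 : forall a, 0 <= p a) (p_sum1 : \sum_a p a = 1).

(** Written as a finite sum of scaled Dirac measures so that the measure structure is inherited. *)
Definition mass_prob : set (borel (discrete T)) -> \bar R :=
  msum (fun i => mscale (NngNum (p_ge0 (nth point (enum T) i)))
                        (\d_(nth point (enum T) i : borel (discrete T)))) #|T|.

HB.instance Definition _ := Measure.on mass_prob.

Let mass_probE B : mass_prob B = (\sum_(b | b \in B) p b)%:E.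
Proof.
rewrite /mass_prob /msum -sumEFin [RHS]big_mkcond/=.
rewrite -[RHS]big_enum/= (big_nth point) -cardE big_mkord.
apply: eq_bigr => i _; rewrite /mscale/= diracE.
by case: (_ \in B); rewrite ?mule1 ?mule0.
Qed.

Let mass_prob_setT : mass_prob setT = 1%E.
Proof.
by rewrite mass_probE (eq_bigl xpredT) ?p_sum1// => b; rewrite in_setT.
Qed.

HB.instance Definition _ :=
  Measure_isProbability.Build _ _ R mass_prob mass_prob_setT.

Lemma exists_mass :
  exists m : probability (borel (discrete T)) R, forall a, mass m a = p a.
Proof.
exists mass_prob => a; rewrite /mass/= mass_probE (big_pred1 a)// => b.
by apply/idP/eqP => [/set_mem//|->]; exact/mem_set.
Qed.

End mass_function_probability.

(** * Cutting an interval into consecutive cells *)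

Section partial_sums.
Context (R : realType) (T : finType) (p : T -> R).
Hypothesis p_ge0 : forall a, 0 <= p a.

(** The cell of [a] runs from [partial_sum (enum_rank a)] to the next partial sum and has length
    [p a]. *)
Definition partial_sum (k : nat) : R := \sum_(a | (enum_rank a < k)%N) p a.

Lemma partial_sum0 : partial_sum 0 = 0.
Proof. by rewrite /partial_sum big_pred0. Qed.

Lemma partial_sumS (a : T) :
  partial_sum (enum_rank a).+1 = partial_sum (enum_rank a) + p a.
Proof.
rewrite /partial_sum (bigD1 a)//= addrC; congr (_ + _); apply: eq_bigl => b.
by rewrite ltnS ltn_neqAle andbC -(inj_eq enum_rank_inj).
Qed.

Lemma partial_sum_card : partial_sum #|T| = \sum_a p a.
Proof. by apply: eq_bigl => a; rewrite ltn_ord. Qed.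

Lemma partial_sum_le i j : (i <= j)%N -> partial_sum i <= partial_sum j.
Proof.
move=> ij; rewrite /partial_sum big_mkcond [leRHS]big_mkcond.
apply: ler_sum => a _; case: ifPn => [ai|_]; last by case: ifPn.
by rewrite (leq_trans ai ij).
Qed.

Lemma partial_sum_ge0 k : 0 <= partial_sum k.
Proof. exact: sumr_ge0. Qed.

Lemma partial_sum_cell x : 0 <= x < \sum_a p a ->
  exists a : T, partial_sum (enum_rank a) <= x < partial_sum (enum_rank a).+1.
Proof.
move=> /andP[x0 xp].
have xk : exists k, x < partial_sum k by exists #|T|; rewrite partial_sum_card.
case: (ex_minnP xk) => -[|k]; first by rewrite partial_sum0 ltNge x0.
move=> xS kmin.
have kT : (k < #|T|)%N by apply: kmin; rewrite partial_sum_card.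
exists (enum_val (Ordinal kT)); rewrite enum_valK/= xS andbT leNgt.
by apply/negP => /kmin; rewrite ltnn.
Qed.

Lemma partial_sum_cell_uniq x (a b : T) :
  partial_sum (enum_rank a) <= x < partial_sum (enum_rank a).+1 ->
  partial_sum (enum_rank b) <= x < partial_sum (enum_rank b).+1 -> a = b.
Proof.
move=> /andP[ax xa] /andP[bx xb]; apply/enum_rank_inj/ord_inj.
case: (ltngtP (enum_rank a) (enum_rank b)) => [| |//] /partial_sum_le h.
  by have := lt_le_trans xa (le_trans h bx); rewrite ltxx.
by have := lt_le_trans xb (le_trans h ax); rewrite ltxx.
Qed.

End partial_sums.

(** * Plays and histories of a single agent *)

Section agent.
Context (R : realType) (N : nat) (O0 : pcountType) (O : 'I_N -> pcountType)
  (A : 'I_N -> pfinType) (n : 'I_N).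

Notation lobs := (O0 * O n)%type.
Notation lstage := (lobs * A n)%type.
Notation policy := (policy R O0 O A n).
Notation pure_policy := (pure_policy R O0 O A n).
Notation hist0n := (hist0n O0 O A n).

(* A play of agent [n] is listed backwards: the latest stage comes first. *)
Implicit Types (z : seq lstage) (o : lobs) (a : A n) (u : policy).

(** [o] is the current observation, not yet answered by an action; histories list the oldest entry
    first, whence [rev]. *)
Definition play_hist z o : hist0n (size z) :=
  ([tuple of rev (o.1 :: map (fun x => x.1.1) (in_tuple z))],
   ([tuple of rev (o.2 :: map (fun x => x.1.2) (in_tuple z))],
    [tuple of rev (map snd (in_tuple z))])).

(** The observation tuples are one longer than the action tuple, so the outer [zip] drops the
    current observation; [hist_obs] recovers it. *)
Definition hist_play t (h : hist0n t) : seq lstage :=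
  rev (zip (zip h.1 h.2.1) h.2.2).

Definition hist_obs t (h : hist0n t) : lobs :=
  (last point h.1, last point h.2.1).

Lemma play_histK z o : hist_play (play_hist z o) = z.
Proof.
rewrite /hist_play /= !rev_cons -!map_rev -!cats1.
rewrite zip_cat ?size_map// -[X in zip _ X]cats0 zip_cat/=; last first.
  by rewrite size_zip !size_map minnn.
rewrite cats0 -[RHS]revK; congr rev.
by elim: (rev z) => //= -[[? ?] ?] s ->.
Qed.

Lemma play_histK_obs z o : hist_obs (play_hist z o) = o.
Proof. by case: o => a b; rewrite /hist_obs /= !rev_cons !last_rcons. Qed.

(** * Policies, realization weights and plans *)

Definition play_policy (b : seq lstage -> lobs -> M1 R (discrete (A n))) :
    policy :=
  fun t h => b (hist_play h) (hist_obs h).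

Definition move u z o a : R := mass (u (size z) (play_hist z o)) a.

Lemma move_play_policy b z o a : move (play_policy b) z o a = mass (b z o) a.
Proof. by rewrite /move /play_policy play_histK play_histK_obs. Qed.

(* The realization weight of Kuhn's theorem: the contribution of [u] to the
   probability of the play [z]. *)
Fixpoint weight u z : R :=
  if z is x :: z' then weight u z' * move u z' x.1 x.2 else 1.

Lemma weight_ge0 u z : 0 <= weight u z.
Proof. by elim: z => //= x z IH; rewrite mulr_ge0// mass_ge0. Qed.

Lemma weight_le1 u z : weight u z <= 1.
Proof.
elim: z => //= x z IH; rewrite mulr_ile1 ?weight_ge0 ?mass_ge0 ?mass_le1//.
Qed.

(** The sum runs over the actions for each fixed observation [o]: observations are drawn by nature,
    and their probabilities belong to the policy-free factor. *)
Definition is_plan (W : seq lstage -> R) : Prop :=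
  [/\ forall z, 0 <= W z, W [::] = 1 &
      forall z o, \sum_a W ((o, a) :: z) = W z].

Lemma weight_plan u : is_plan (weight u).
Proof.
split=> [z||z o] //=; first exact: weight_ge0.
by rewrite -mulr_sumr mass_sum1 mulr1.
Qed.

Lemma plan_policy W : is_plan W -> exists u, weight u = W.
Proof.
move=> [W0 W1 WS].
have /choice[b bE] : forall zo : seq lstage * lobs,
    exists m : probability (borel (discrete (A n))) R,
    forall a, W zo.1 * mass m a = W ((zo.2, a) :: zo.1).
  move=> [z ob] /=; have [Wz0|Wz] := eqVneq (W z) 0.
    (* If [W z = 0], then [W] vanishes at every one-stage extension of [z] too, by nonnegativity and
       the plan condition; any probability would do here. *)
    exists (\d_(point : borel (discrete (A n)))) => a; rewrite Wz0 mul0r.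
    apply/esym/eqP; rewrite eq_le W0 andbT -Wz0 -(WS z ob).
    by rewrite (bigD1 a)//= lerDl sumr_ge0.
  have p0 a : 0 <= W ((ob, a) :: z) / W z by rewrite divr_ge0.
  have p1 : \sum_a W ((ob, a) :: z) / W z = 1 by rewrite -mulr_suml WS divff.
  by have [m mE] := exists_mass p0 p1; exists m => a; rewrite mE mulrC divfK.
exists (play_policy (fun z o => b (z, o))); apply/funext.
by elim=> [|[ob a] z IH] //=; rewrite IH move_play_policy (bE (z, ob)).
Qed.

(** * Mean weights of random policies *)

Section random_policy.
Context d (T : measurableType d) (mu : probability T R) (v : T -> policy).
Hypothesis measurable_v : forall t (h : hist0n t) a,
  measurable_fun setT (fun x => mass ((v x) t h) a).

Lemma measurable_weight z : measurable_fun setT (fun x => weight (v x) z).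
Proof.
elim: z => [|x z IH] /=; first exact: measurable_cst.
by apply: measurable_funM IH _; exact: measurable_v.
Qed.

Definition mean_weight z : R := fine (\int[mu]_x (weight (v x) z)%:E)%E.

(** Weights lie between 0 and 1, so the integral is finite and [fine] loses nothing. *)
Lemma mean_weightE z : (\int[mu]_x (weight (v x) z)%:E)%E = (mean_weight z)%:E.
Proof.
rewrite /mean_weight fineK// ge0_fin_numE; last first.
  by apply: integral_ge0 => x _; rewrite lee_fin weight_ge0.
apply: (@le_lt_trans _ _ (\int[mu]_x (cst 1 x))%E).
  apply: ge0_le_integral => //.
  - by move=> x _; rewrite lee_fin weight_ge0.
  - exact/measurable_EFinP/measurable_weight.
  - by move=> x _; rewrite lee_fin weight_le1.
rewrite integral_cst// mul1e [X in (X < _)%E](_ : _ = 1%E) ?ltry//.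
exact: probability_setT.
Qed.

(** Each [weight (v x)] is a plan, and the conditions survive averaging: the finite sum over actions
    commutes with the integral, and total mass 1 gives the value at [[::]]. *)
Lemma mean_weight_plan : is_plan mean_weight.
Proof.
split=> [z||z o].
- by apply/fine_ge0/integral_ge0 => x _; rewrite lee_fin weight_ge0.
- rewrite /mean_weight /= integral_cst// mul1e.
  exact: (congr1 fine (probability_setT mu)).
apply: EFin_inj; rewrite -sumEFin -mean_weightE.
under eq_bigr do rewrite -mean_weightE.
rewrite -ge0_integral_sum//.
- apply: eq_integral => x _ /=.
  by rewrite sumEFin -mulr_sumr mass_sum1 mulr1.
- by move=> a; apply/measurable_EFinP; exact: measurable_weight.
- by move=> a x _; rewrite lee_fin weight_ge0.
Qed.

End random_policy.

(** * Measurability of policy evaluations and of maps into pure policies *)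

Lemma policy_mass_continuous t (h : hist0n t) a :
  continuous (fun u : policy => mass (u t h) a).
Proof.
move=> u; apply: (@continuous_comp policy (M1 R (discrete (A n))) R
  (fun u : policy => u t h) (fun m : M1 R (discrete (A n)) => mass m a));
  last exact: mass_continuous.
apply: (@continuous_comp policy
  (prod_topology (fun _ : hist0n t => M1 R (discrete (A n)))) _
  (fun u : policy => u t) (fun g => g h)).
  exact: (@prod_topology_continuous _ (fun t => prod_topology
    (fun _ : hist0n t => M1 R (discrete (A n))))).
exact: prod_topology_continuous.
Qed.

Lemma policy_mass_measurable t (h : hist0n t) a :
  measurable_fun setT (fun u : borel policy => mass ((u : policy) t h) a).
Proof.
by apply: borel_measurable_continuous; exact: policy_mass_continuous.
Qed.

Lemma pure_policy_mass_measurable t (h : hist0n t) a :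
  measurable_fun setT
    (fun w : borel pure_policy =>
       mass ((set_val (w : pure_policy) : policy) t h) a).
Proof.
apply: borel_measurable_continuous => w.
apply: (@continuous_comp pure_policy policy R set_val
  (fun u : policy => mass (u t h) a)); last exact: policy_mass_continuous.
exact: initial_continuous.
Qed.

Lemma pure_mass1 u t (h : hist0n t) a : is_pure u -> mass (u t h) a = 1 ->
  (u t h : probability _ _) = \d_(a : borel (discrete (A n)))
    :> (set _ -> \bar R).
Proof.
move=> /(_ t h)[b ub].
rewrite (_ : mass (u t h) a = mass (\d_(b : borel (discrete (A n)))) a);
  last first.
  by rewrite /mass ub.
rewrite mass_dirac; have [<- _|_ /esym/eqP] := eqVneq b a; first exact: ub.
by rewrite oner_eq0.
Qed.

(** [l] prescribes the actions at finitely many histories; such lists form a countable type. *)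
Definition cylinder (l : seq {t : nat & (hist0n t * A n)%type}) :
    set pure_policy :=
  [set w | forall i, i \in l ->
    mass ((set_val w : policy) (tag i) (tagged i).1) (tagged i).2 = 1].

(** It suffices to treat one time, one history and one test function. Prescribing the action of [w]
    there forces the same Dirac measure, so the integral of the test function is constant on the
    cylinder. *)
Lemma cylinder_cvg (w : pure_policy) :
  filter_from [set l | cylinder l w] cylinder --> w.
Proof.
have FF : Filter (filter_from [set l | cylinder l w] cylinder).
  apply: filter_from_filter; first by exists [::].
  move=> l1 l2 w1 w2; exists (l1 ++ l2) => [i|w' w'l].
    by rewrite mem_cat => /orP[/w1|/w2].
  by split=> i il; apply: w'l; rewrite mem_cat il ?orbT.
apply: cvg_initial; apply: cvg_prod_topology => t.
apply: cvg_prod_topology => h; apply: cvg_initial.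
apply: cvg_prod_topology => f.
have [a wa] := set_valP w t h.
move=> B /nbhs_singleton Bw; exists [:: existT _ t (h, a)].
  by move=> i; rewrite inE => /eqP -> /=; rewrite /mass wa diracE mem_set.
move=> w' /(_ _ (mem_head _ _))/= w'a /=.
have w'E := etrans (pure_mass1 (set_valP w') w'a) (esym wa).
suff -> : weak_eval ((set_val w' : policy) t h) f =
    weak_eval ((set_val w : policy) t h) f by [].
congr fine; apply: eq_measure_integral => C _ _; exact: (congr1 (@^~ C)).
Qed.

(* The cylinders are countably many and a base of the topology, so an open set
   is a countable union of them. *)
Lemma measurable_pure_policy d (T : measurableType d) (v : T -> pure_policy) :
  (forall t (h : hist0n t) a,
    measurable_fun setT (fun x => mass ((set_val (v x) : policy) t h) a)) ->
  measurable_fun setT (v : T -> borel pure_policy).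
Proof.
move=> mv; apply: (@measurability _ _ _ _ setT (v : T -> borel pure_policy)
  (@open pure_policy)) => //.
move=> _ [U oU <-]; rewrite setTI.
rewrite (_ : _ @^-1` U =
    \bigcup_(l in [set l | cylinder l `<=` U]) (v @^-1` cylinder l)).
  rewrite bigcup_mkcond; apply: countable_bigcupT_measurable => [|l].
    exact: countableP.
  case: ifPn => // _; elim: l => [|i l IH].
    by rewrite (_ : _ @^-1` _ = setT)//; apply/seteqP; split.
  rewrite (_ : _ @^-1` _ =
    (fun x => mass ((set_val (v x) : policy) (tag i) (tagged i).1) (tagged i).2)
      @^-1` [set 1] `&` v @^-1` cylinder l); last first.
    apply/seteqP; split => x /= => [xl|[xi xl] k].
      by split=> [|k kl]; apply: xl; rewrite inE ?eqxx// kl orbT.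
    by rewrite inE => /predU1P[->//|]; exact: xl.
  apply: measurableI => //; rewrite -[X in measurable X]setTI.
  exact: mv.
apply/seteqP; split => x /=; last by move=> [l lU]; exact: lU.
move=> vU; have : nbhs (v x) U by exact: open_nbhs_nbhs.
by move=> /cylinder_cvg[l xl lU]; exists l.
Qed.

(** * Random pure policies from nested intervals *)

Section plan_randomization.
Variable W : seq lstage -> R.
Hypothesis planW : is_plan W.

(** The segment of [z] is cut anew for each next observation, into cells ordered by the rank of the
    action; cells for different observations may overlap. *)
Fixpoint left_end z : R :=
  if z is x :: z' then
    left_end z' + partial_sum (fun a => W ((x.1, a) :: z')) (enum_rank x.2)
  else 0.

Definition segment z : set R := `[left_end z, left_end z + W z[%classic.

(** Outside the segment of [z] no cell contains [x], and the default [point] is played. *)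
Definition segment_act x z o : A n :=
  odflt point [pick a | x \in segment ((o, a) :: z)].

(** For fixed [o], the plan condition makes the cells of the actions a partition of the segment of
    [z]. *)
Lemma segment_consP z o a (x : R) : segment ((o, a) :: z) x <->
  segment z x /\ segment_act x z o = a.
Proof.
have [W0 W1 WS] := planW.
pose p b := W ((o, b) :: z); pose y := x - left_end z.
have segE b : segment ((o, b) :: z) x <->
    partial_sum p (enum_rank b) <= y < partial_sum p (enum_rank b).+1.
  rewrite /segment /= in_itv/= partial_sumS -/p /y lerBrDl ltrBlDl addrA.
  by rewrite /p.
have segzE : segment z x <-> 0 <= y < \sum_b p b.
  by rewrite /segment /= in_itv/= WS /y subr_ge0 ltrBlDl.
have p0 b : 0 <= p b by exact: W0.
have uniq b c : segment ((o, b) :: z) x -> segment ((o, c) :: z) x -> b = c.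
  by move=> /segE bx /segE; exact: partial_sum_cell_uniq.
rewrite /segment_act; split => [xa|[/segzE/partial_sum_cell[b /segE xb]]].
  split; last first.
    case: pickP => [b /set_mem xb|/(_ a)] /=; first exact: uniq xa.
    by rewrite mem_set.
  move/segE: xa => /andP[ya ay]; apply/segzE/andP; split.
    exact: le_trans (partial_sum_ge0 p0 _) ya.
  by apply: lt_le_trans ay _; rewrite -partial_sum_card partial_sum_le.
case: pickP => [c /set_mem xc /= <- //|/(_ b)] /=.
by rewrite mem_set.
Qed.

Lemma segment_sub z : segment z `<=` `[0, 1[.
Proof.
have [_ W1 _] := planW.
elim: z => [|[ob a] z IH] x; last by move=> /segment_consP[/IH].
by rewrite /segment /= W1 add0r.
Qed.

Definition segment_policy (x : R) : policy :=
  play_policy (fun z o => \d_(segment_act x z o : borel (discrete (A n)))).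

Lemma segment_policy_pure x : is_pure (segment_policy x).
Proof. by move=> t h; eexists. Qed.

(** The weight of this pure policy is 1 exactly when [x] selects every action of [z] in turn, that
    is, lies in all the nested segments. The base case uses that the segment of [[::]] is the whole
    interval. *)
Lemma weight_segment_policy x z : `[0, 1[%classic x ->
  weight (segment_policy x) z = \1_(segment z) x.
Proof.
have [_ W1 _] := planW.
move=> x01; elim: z => [|[ob a] z IH] /=.
  by rewrite indicE mem_set// /segment /= W1 add0r.
rewrite IH move_play_policy mass_dirac !indicE -natrM mulnb.
congr (nat_of_bool _)%:R.
apply/andP/idP => [[/set_mem xz /eqP xa]|/set_mem/segment_consP[xz xa]].
  exact/mem_set/segment_consP.
by split; [exact/mem_set|exact/eqP].
Qed.

Lemma measurable_segment z : measurable (segment z).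
Proof. exact: measurable_itv. Qed.

Lemma measurable_segment_policy t (h : hist0n t) a :
  measurable_fun setT
    (fun x : measurableTypeR R => mass ((segment_policy x) t h) a).
Proof.
pose z := hist_play h; pose o := hist_obs h.
(* The policy plays [a] on the cell of [a] and, when [a] is the default [point], also outside the
   segment of [z]. *)
pose E := segment ((o, a) :: z) `|` (if a == point then ~` segment z else set0).
have mE : measurable E.
  apply: measurableU; first exact: measurable_segment.
  case: ifPn => // _; apply: measurableC; exact: measurable_segment.
rewrite (_ : (fun _ => _) = \1_E); first exact: measurable_indic.
apply/funext => x; rewrite mass_dirac indicE; congr (nat_of_bool _)%:R.
rewrite -/z -/o.
have [xz|xz] := pselect (segment z x).
  apply/eqP/idP => [xa|/set_mem[/segment_consP[]//|]].
    by apply/mem_set; left; apply/segment_consP.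
  by case: ifP => // _ /(_ xz).
have -> : segment_act x z o = point.
  rewrite /segment_act; case: pickP => //= b /set_mem/segment_consP[xz' _].
  by exfalso.
apply/eqP/idP => [pa|/set_mem[/segment_consP[]//|]].
  by apply/mem_set; right; rewrite -pa eqxx.
by case: eqP => // ->.
Qed.

(** [mu] is the law of [segment_policy x] for uniform [x]; the mean weight of [z] is then the length
    of its segment, namely [W z]. *)
Lemma plan_pure_policy : exists mu : probability (borel pure_policy) R,
  forall z, (\int[mu]_w (weight (set_val (w : pure_policy)) z)%:E)%E = (W z)%:E.
Proof.
have [W0 W1 WS] := planW.
pose v x : pure_policy := SigSub (mem_set (segment_policy_pure x)).
have mv : measurable_fun setT (v : measurableTypeR R -> borel pure_policy).
  by apply: measurable_pure_policy => t h a; exact: measurable_segment_policy.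
pose mv_mixin := isMeasurableFun.Build _ _ _ _ _ mv.
pose V : {mfun measurableTypeR R >-> borel pure_policy} :=
  HB.pack (v : measurableTypeR R -> borel pure_policy) mv_mixin.
exists (distribution (uniform_prob (@ltr01 R)) V) => z.
have mw : measurable_fun setT
    (fun w : borel pure_policy => (weight (set_val (w : pure_policy)) z)%:E).
  apply/measurable_EFinP; apply: measurable_weight => t h a.
  exact: pure_policy_mass_measurable.
rewrite ge0_integral_pushforward//; last first.
  by move=> w _; rewrite lee_fin weight_ge0.
rewrite preimage_setT integral_uniform//; last 2 first.
- exact: measurableT_comp mw mv.
- by move=> x; rewrite lee_fin weight_ge0.
(* The uniform law integrates over the closed unit interval; dropping the null endpoint 1 gives the
   half-open one, where [weight_segment_policy] applies. *)
rewrite subr0 invr1 mul1e -integral_itv_bndo_bndc; last first.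
  by apply: measurable_funTS; exact: measurableT_comp mw mv.
rewrite (eq_integral (fun x : measurableTypeR R => (\1_(segment z) x)%:E)) =>
  [|x /set_mem x01 /=].
  rewrite integral_indic// ?setIidl; last 2 first.
  - exact: segment_sub.
  - exact: measurable_segment.
  rewrite /= /segment lebesgue_measure_itv/= lte_fin ltrDl.
  have := W0 z; rewrite le_eqVlt => /predU1P[<-|->]; first by rewrite ltxx.
  by rewrite -EFinB addrAC subrr add0r.
by rewrite -weight_segment_policy.
Qed.

End plan_randomization.

Lemma plan_mixture W : is_plan W -> exists mu : probability (borel policy) R,
  forall z, (\int[mu]_u (weight (u : policy) z)%:E)%E = (W z)%:E.
Proof.
move=> /plan_policy[u <-]; exists (\d_(u : borel policy)) => z.
rewrite integral_dirac//; first by rewrite diracT mul1e.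
apply/measurable_EFinP; apply: measurable_weight => t h a.
exact: policy_mass_measurable.
Qed.

End agent.

(** * Factorization of path probabilities over the agents *)

Section model.
Context (R : realType) (N : nat) (S : ptopologicalType).
Context (O0 : pcountType) (O : 'I_N -> pcountType) (A : 'I_N -> pfinType).
Context (P1 : probability (borel S * borel (discrete (obs O0 O)))%type R).
Context (P : R.-pker (borel S * borel (discrete (act A)))%type ~>
                     (borel S * borel (discrete (obs O0 O)))%type).

Notation obs := (obs O0 O).
Notation act := (act A).
Notation stage := (stage S O0 O A).
Notation profile := (profile R O0 O A).
Notation next_state_obs := (next_state_obs P1 P).
Notation path_prob := (path_prob P1 P).
Notation lstage n := (O0 * O n * A n)%type.

Implicit Types (u : profile) (w : seq stage) (l : seq (obs * act)).

Definition local_stage n (x : obs * act) : lstage n :=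
  ((x.1.1, (x.1.2 : {dffun _}) n), (x.2 : {dffun _}) n).

Definition local_play n l : seq (lstage n) := map (local_stage n) l.

(** Latest stage first, as in the plays, so that a new stage is put at the head of each local
    play. *)
Definition erase_states w : seq (obs * act) :=
  rev (map (fun z : stage => (z.1.2, z.2)) w).

Definition joint_weight (W : forall n, seq (lstage n) -> R) l : R :=
  \prod_(n < N) W n (local_play n l).

(** Histories at [t] and [t'] have different types, so they are compared through their underlying
    sequences. *)
Lemma policy_eq_hist n (v : policy R O0 O A n) t t'
    (h : hist0n O0 O A n t) (h' : hist0n O0 O A n t') :
  t = t' -> h.1 = h'.1 :> seq _ -> h.2.1 = h'.2.1 :> seq _ ->
  h.2.2 = h'.2.2 :> seq _ -> v t h = v t' h'.
Proof.
move=> tt'; subst t'; case: h h' => [c [ob ac]] [c' [ob' ac']] /=.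
by move=> /val_inj -> /val_inj -> /val_inj ->.
Qed.

Lemma act_probE u w (o : obs) (a : act) :
  act_prob u (hist_after w o) a = (\prod_(n < N)
    move (u n) (local_play n (erase_states w))
      (o.1, (o.2 : {dffun _}) n) ((a : {dffun _}) n))%:E.
Proof.
rewrite -prodEFin; apply: eq_bigr => n _.
rewrite massE /move; congr (mass _ _)%:E.
apply: policy_eq_hist.
- by rewrite size_map size_rev size_map.
- by rewrite /= rev_cons map_rcons -!map_rev revK -!map_comp.
- by rewrite /= rev_cons map_rcons -!map_rev revK -!map_comp.
- by rewrite /= -!map_rev revK -!map_comp.
Qed.

Lemma joint_weight_rcons u w (z : stage) :
  joint_weight (fun n => weight (u n)) (erase_states (rcons w z)) =
  joint_weight (fun n => weight (u n)) (erase_states w) *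
  \prod_(n < N) move (u n) (local_play n (erase_states w))
      (z.1.2.1, (z.1.2.2 : {dffun _}) n) ((z.2 : {dffun _}) n).
Proof.
rewrite -big_split/=; apply: eq_bigr => n _.
by rewrite /erase_states map_rcons rev_rcons.
Qed.

(** The case analysis on [w] hides the measure structure; exposing it lets integration lemmas
    apply. *)
Lemma next_state_obs_measure w :
  exists m : {measure set (borel S * borel (discrete obs)) -> \bar R},
    next_state_obs w = m.
Proof.
by rewrite /next_state_obs; case: (rev w) => [|[[s o] a] ?]; eexists.
Qed.

(* The factor of [path_prob] that does not depend on the policies. *)
Fixpoint path_mass (k : nat) w (E : set (seq stage)) : \bar R :=
  if k is k'.+1 then
    (\int[next_state_obs w]_so
       \sum_(a : act) path_mass k' (rcons w (so.1, so.2, a)) E)%E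
  else (\1_E w)%:E.

Lemma act_prob_ge0 u t (h : hist O0 O A t) a : (0 <= act_prob u h a)%E.
Proof. by apply: prode_ge0 => n _; exact: measure_ge0. Qed.

Lemma path_prob_ge0 u k w E : (0 <= path_prob u k w E)%E.
Proof.
elim: k w => [|k IH] w /=; first by rewrite lee_fin.
have [m ->] := next_state_obs_measure w.
apply: integral_ge0 => so _; apply: sume_ge0 => a _.
by rewrite mule_ge0// act_prob_ge0.
Qed.

Lemma path_mass_ge0 k w E : (0 <= path_mass k w E)%E.
Proof.
elim: k w => [|k IH] w /=; first by rewrite lee_fin.
have [m ->] := next_state_obs_measure w.
by apply: integral_ge0 => so _; exact: sume_ge0.
Qed.

(* Multiplying by the weight of the past [w] makes the induction go through
   also when [w] is not a prefix of the target: both sides then vanish. *)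
Lemma path_prob_factor u k w l (E := [set w | erase_states w = l])
    (W := fun n => weight (u n)) :
  ((joint_weight W (erase_states w))%:E * path_prob u k w E =
   (joint_weight W l)%:E * path_mass k w E)%E.
Proof.
have W0 l' : 0 <= joint_weight W l'.
  by apply: prodr_ge0 => n _; exact: weight_ge0.
elim: k w => [|k IH] w /=.
  have [<- //|wl] := pselect (erase_states w = l).
  by rewrite indicE memNset// !mule0.
have [m ->] := next_state_obs_measure w.
(* The weights do not depend on [so] and move under the integral without any measurability of the
   integrands. *)
rewrite -!ge0_nonmeasurable_integralZl//; last 2 first.
- by move=> so; apply: sume_ge0 => a _; exact: path_mass_ge0.
- move=> so; apply: sume_ge0 => a _.
  by rewrite mule_ge0 ?act_prob_ge0 ?path_prob_ge0.
apply: eq_integral => so _.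
rewrite !ge0_sume_distrr; last 2 first.
- by move=> a _; exact: path_mass_ge0.
- by move=> a _; rewrite mule_ge0 ?act_prob_ge0 ?path_prob_ge0.
apply: eq_bigr => a _.
by rewrite -IH joint_weight_rcons act_probE muleA EFinM.
Qed.

(** * Occupation measures in terms of plans *)

Definition target (x : hist_act O0 O A) : seq (obs * act) :=
  rev (zip (tagged x).1.1 (rcons (tagged x).1.2 (tagged x).2)).

Lemma hist_act_eventE (x : hist_act O0 O A) :
  hist_act_event (tagged x).1 (tagged x).2 =
  [set w : seq stage | erase_states w = target x].
Proof.
case: x => t [[os acs] a]; rewrite /target/=.
have sz : size os = size (rcons acs a) by rewrite size_rcons !size_tuple.
apply/seteqP; split => w /=.
  move=> [<- <-]; rewrite /erase_states; congr rev.
  by elim: w {sz} => //= z w ->.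
move=> /(congr1 rev); rewrite /erase_states !revK => wE; split.
  by rewrite -[RHS](unzip1_zip (eq_leq sz)) -wE /unzip1 -map_comp.
by rewrite -[RHS](unzip2_zip (eq_leq (esym sz))) -wE /unzip2 -map_comp.
Qed.

Definition plan_occupation (W : forall n, seq (lstage n) -> R) :
    hist_act O0 O A -> \bar R := fun x =>
  ((joint_weight W (target x))%:E *
   path_mass (tag x).+1 [::] (hist_act_event (tagged x).1 (tagged x).2))%E.

Lemma occupationE u :
  occupation P1 P u = plan_occupation (fun n => weight (u n)).
Proof.
apply/funext => x; rewrite /plan_occupation /occupation !hist_act_eventE.
(* The factorization is used at the empty past, where every agent's weight is 1. *)
rewrite -path_prob_factor /joint_weight big1 ?mul1e//.
Qed.

(** The policy-free factor leaves the integral, and under the product probability the mean of the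
    product of the weights is the product of their means. [T n] will be the space of behavioral or
    of pure policies, so both kinds of mixture are covered. *)
Lemma integral_occupation (d : 'I_N -> measure_display)
    (T : forall n, measurableType (d n)) (mu : forall n, probability (T n) R)
    (v : forall n, T n -> policy R O0 O A n) (V : prod_space T -> profile)
    (W : forall n, seq (lstage n) -> R) :
  (forall y n, V y n = v n (y n)) ->
  (forall n t (h : hist0n O0 O A n t) a,
    measurable_fun setT (fun x => mass ((v n x) t h) a)) ->
  (forall n z, (\int[mu n]_x (weight (v n x) z)%:E)%E = (W n z)%:E) ->
  (fun x => \int[prod_probability mu]_y occupation P1 P (V y) x)%E =
  plan_occupation W.
Proof.
move=> VE mv WE; apply/funext => x.
under eq_integral => y _.
  rewrite occupationE /plan_occupation /joint_weight muleC.
  under eq_bigr do rewrite VE.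
  over.
have mw n : measurable_fun setT
    (fun y => weight (v n y) (local_play n (target x))).
  by apply: measurable_weight => t h a; exact: mv.
rewrite ge0_integralZl//; last 3 first.
- apply/measurable_EFinP/measurable_prod => n _.
  exact: measurableT_comp (mw n) (@measurable_coordinate _ _ _ n).
- by move=> y _; rewrite lee_fin prodr_ge0// => n _; exact: weight_ge0.
- exact: path_mass_ge0.
rewrite muleC /joint_weight; congr (_ * _)%E.
rewrite (@ge0_integral_prod _ _ _ _ mu
  (fun n (y : T n) => weight (v n y) (local_play n (target x))))//.
  by rewrite -prodEFin; apply: eq_bigr => n _; rewrite WE.
by move=> n y; exact: weight_ge0.
Qed.

(** * Identification of the three sets of occupation measures *)

Definition plan_occupations : set (hist_act O0 O A -> \bar R) :=
  [set plan_occupation W | W in [set W | forall n, is_plan (W n)]].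

Lemma range_occupation : range (occupation P1 P) = plan_occupations.
Proof.
apply/seteqP; split => [_ [u _ <-]|_ [W planW <-]].
  exists (fun n => weight (u n)); last by rewrite occupationE.
  by move=> n; exact: weight_plan.
pose u n := projT1 (cid (plan_policy (planW n))).
exists u => //; rewrite occupationE; congr plan_occupation.
by apply: functional_extensionality_dep => n; rewrite /u; case: cid.
Qed.

Lemma range_occupation_mixture :
  range (occupation_mixture P1 P) = plan_occupations.
Proof.
apply/seteqP; split => [_ [mu _ <-]|_ [W planW <-]].
  exists (fun n => mean_weight (mu n : probability _ R) id).
    move=> n; apply: mean_weight_plan => t h a.
    exact: policy_mass_measurable.
  apply/esym; apply: (@integral_occupation _
    (fun n => borel (policy R O0 O A n)) mu
    (fun n (u : policy R O0 O A n) => u)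
    (fun u : profile => u)) => [//|n t h a|n z].
    exact: policy_mass_measurable.
  by apply: mean_weightE => t h a; exact: policy_mass_measurable.
pose mu n := projT1 (cid (plan_mixture (planW n))).
exists mu => //; apply: (@integral_occupation _
  (fun n => borel (policy R O0 O A n)) mu
  (fun n (u : policy R O0 O A n) => u)
  (fun u : profile => u)) => [//|n t h a|n z].
  exact: policy_mass_measurable.
by rewrite /mu; case: cid.
Qed.

Lemma range_occupation_pure_mixture :
  range (occupation_pure_mixture P1 P) = plan_occupations.
Proof.
apply/seteqP; split => [_ [mu _ <-]|_ [W planW <-]].
  exists (fun n => mean_weight (mu n : probability _ R) set_val).
    move=> n; apply: mean_weight_plan => t h a.
    exact: pure_policy_mass_measurable.
  apply/esym; apply: (@integral_occupation _
    (fun n => borel (pure_policy R O0 O A n)) mu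
    (fun n (w : pure_policy R O0 O A n) => set_val w)
    (fun w : forall n, pure_policy R O0 O A n => pure_profile_val w)) =>
  [//|n t h a|n z].
    exact: pure_policy_mass_measurable.
  by apply: mean_weightE => t h a; exact: pure_policy_mass_measurable.
pose mu n := projT1 (cid (plan_pure_policy (planW n))).
exists mu => //; apply: (@integral_occupation _
    (fun n => borel (pure_policy R O0 O A n)) mu
    (fun n (w : pure_policy R O0 O A n) => set_val w)
    (fun w : forall n, pure_policy R O0 O A n => pure_profile_val w)) =>
  [//|n t h a|n z].
  exact: pure_policy_mass_measurable.
by rewrite /mu; case: cid.
Qed.

End model.

Theorem theorem3 (R : realType) (N : nat) (hN : (0 < N)%N)
    (S : ptopologicalType) (O0 : pcountType) (O : 'I_N -> pcountType)
    (A : 'I_N -> pfinType)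
    (P1 : probability (borel S * borel (discrete (obs O0 O)))%type R)
    (P : R.-pker (borel S * borel (discrete (act A)))%type ~>
                 (borel S * borel (discrete (obs O0 O)))%type) :
  range (occupation P1 P) = range (occupation_mixture P1 P) /\
  range (occupation_mixture P1 P) = range (occupation_pure_mixture P1 P).
Proof.
by rewrite range_occupation range_occupation_mixture
  range_occupation_pure_mixture.
Qed.
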